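(* Let $(\mathcal A,\sigma)$ be an involutive ring and let $M=\begin{bmatrix}A&B\\C&D\end{bmatrix}\in \mathrm{Mat}_2(\mathcal A)$. Then $$\sigma(M)M-\sigma(\mathrm{tr}(M))\,M=-\begin{bmatrix}\sigma(\det_l(M)) & {}^{\sigma}[D,B]\\ {}^{\sigma}[A,C] & \det_l(M)\end{bmatrix}.$$ In particular, an element $M\in \mathrm{Mat}_2(\mathcal A)$ lies in $\mathrm{Sp}_2(\mathcal A,\sigma)^l$ if and only if $$\sigma(M)M-\sigma(\mathrm{tr}(M))\,M+\mathrm{Id}=0 .$$
   Context: An involutive ring $(\mathcal A,\sigma)$ is a unital (possibly noncommutative) ring $\mathcal A$ with an anti-involution $\sigma:\mathcal A\to\mathcal A$, i.e. $\sigma$ is additive, $\sigma(XY)=\sigma(Y)\sigma(X)$, $\sigma(\sigma(X))=X$ (and $\sigma(1)=1$). For a $2\times 2$ matrix $M$ over $\mathcal A$, $\sigma(M)$ denotes the matrix obtained by applying $\sigma$ to each entry (no transposition), and $M^T$ is the plain transpose. For $M=\begin{bmatrix}A&B\\C&D\end{bmatrix}$ put $\mathrm{tr}(M)=A+D\in\mathcal A$ and $\det_l(M)=\sigma(A)D-\sigma(C)B\in\mathcal A$. For $X,Y\in\mathcal A$, the left twisted commutator is ${}^{\sigma}[X,Y]=\sigma(X)Y-\sigma(Y)X$. For $c\in\mathcal A$ the product $cM$ multiplies every entry of $M$ by $c$ on the left. With $\Omega_1=\begin{bmatrix}0&1\\-1&0\end{bmatrix}$, the left symplectic monoid is $\mathrm{Sp}_2(\mathcal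 A,\sigma)^l=\{M\in\mathrm{Mat}_2(\mathcal A): \sigma(M)^T\,\Omega_1\,M=\Omega_1\}$. *)

(* Defs.v *)
From mathcomp Require Import all_boot all_order all_algebra.

Set Implicit Arguments.
Unset Strict Implicit.
Unset Printing Implicit Defensive.

Import GRing.Theory.
Local Open Scope ring_scope.

Record anti_involution (R : pzRingType) (sigma : R -> R) : Prop :=
  AntiInvolution {
    anti_involD : {morph sigma : x y / x + y};
    anti_involM : forall x y, sigma (x * y) = sigma y * sigma x;
    anti_involK : involutive sigma;
    anti_invol1 : sigma 1 = 1
  }.

Definition mx2 (R : Type) (a b c d : R) : 'M[R]_2 :=
  \matrix_(i, j) if i == 0 then (if j == 0 then a else b)
                 else (if j == 0 then c else d).

Definition det_l (R : pzRingType) (sigma : R -> R) (M : 'M[R]_2) : R :=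
  sigma (M 0 0) * M 1 1 - sigma (M 1 0) * M 0 1.

Definition twisted_comm_l (R : pzRingType) (sigma : R -> R) (x y : R) : R :=
  sigma x * y - sigma y * x.

Definition Omega1 (R : pzRingType) : 'M[R]_2 := mx2 0 1 (-1) 0.

Definition Sp2_l (R : pzRingType) (sigma : R -> R) : pred 'M[R]_2 :=
  [pred M | (map_mx sigma M)^T *m Omega1 R *m M == Omega1 R].

(* Main.v *)
Require Import Defs.
From mathcomp Require Import all_boot all_order all_algebra.

Set Implicit Arguments.
Unset Strict Implicit.
Unset Printing Implicit Defensive.

Import GRing.Theory.
Local Open Scope ring_scope.

(** Write M = [A B; C D].  In sigma(M) M - sigma(tr M) M the square sigma(A) A
    of the first row cancels against sigma(A) A in sigma(A + D) A, and likewise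
    in every other entry one of the two summands of the matrix product cancels;
    what is left is, up to sign, a twisted commutator off the diagonal, det_l M
    in the lower right corner, and sigma(D) A - sigma(B) C in the upper left
    one.  The last is sigma(det_l M) because sigma reverses products and is an
    involution ([Cayley_Hamilton_mx2]).

    For the symplectic criterion, the matrix sigma(M)^T Omega1 M turns out to
    have the same four entries up to position and sign ([symplectic_form_mx2]).
    Hence both conditions on M say that the two twisted commutators vanish and
    that det_l M = 1; the fourth equation sigma(det_l M) = 1 is then automatic
    from sigma(1) = 1. *)

Lemma ord2P (i : 'I_2) : {i = 0} + {i = 1}.
Proof. by case: i => [[|[|//]] lti2]; [left | right]; apply: val_inj. Qed.

Lemma mx2_eta (T : Type) (M : 'M[T]_2) :
  M = mx2 (M 0 0) (M 0 1) (M 1 0) (M 1 1).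
Proof.
apply/matrixP => i j; rewrite !mxE.
by case: (ord2P i) => ->; case: (ord2P j) => ->.
Qed.

Lemma mx2_inj (T : Type) (a b c d a' b' c' d' : T) :
  mx2 a b c d = mx2 a' b' c' d' -> [/\ a = a', b = b', c = c' & d = d'].
Proof.
by move/matrixP=> E; move: (E 0 0) (E 0 1) (E 1 0) (E 1 1); rewrite !mxE.
Qed.

Lemma map_mx2 (T U : Type) (f : T -> U) (a b c d : T) :
  map_mx f (mx2 a b c d) = mx2 (f a) (f b) (f c) (f d).
Proof. by rewrite [LHS]mx2_eta !mxE. Qed.

Lemma trmx_mx2 (T : Type) (a b c d : T) : (mx2 a b c d)^T = mx2 a c b d.
Proof. by rewrite [LHS]mx2_eta !mxE. Qed.

Section Mx2Ring.

Variable R : pzRingType.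
Implicit Types a b c d x : R.

Lemma mul_mx2 a b c d a' b' c' d' :
  mx2 a b c d *m mx2 a' b' c' d' =
  mx2 (a * a' + b * c') (a * b' + b * d') (c * a' + d * c') (c * b' + d * d').
Proof.
by rewrite [LHS]mx2_eta !mxE !big_ord_recl !big_ord0 !mxE /= !addr0.
Qed.

Lemma add_mx2 a b c d a' b' c' d' :
  mx2 a b c d + mx2 a' b' c' d' = mx2 (a + a') (b + b') (c + c') (d + d').
Proof. by rewrite [LHS]mx2_eta !mxE. Qed.

Lemma opp_mx2 a b c d : - mx2 a b c d = mx2 (- a) (- b) (- c) (- d).
Proof. by rewrite [LHS]mx2_eta !mxE. Qed.

Lemma scale_mx2 x a b c d :
  x *: mx2 a b c d = mx2 (x * a) (x * b) (x * c) (x * d).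
Proof. by rewrite [LHS]mx2_eta !mxE. Qed.

Lemma trace_mx2 a b c d : \tr (mx2 a b c d) = a + d.
Proof. by rewrite /mxtrace !big_ord_recl big_ord0 !mxE addr0. Qed.

Lemma one_mx2 : 1%:M = mx2 1 0 0 1 :> 'M[R]_2.
Proof. by rewrite [LHS]mx2_eta !mxE. Qed.

Variables (sigma : R -> R) (sigmaP : anti_involution sigma).

Lemma anti_involB : {morph sigma : x y / x - y}.
Proof.
move=> x y; apply: (addIr (sigma y)).
by rewrite -(anti_involD sigmaP) !subrK.
Qed.

Lemma det_l_mx2 a b c d :
  det_l sigma (mx2 a b c d) = sigma a * d - sigma c * b.
Proof. by rewrite /det_l !mxE. Qed.

Lemma anti_invol_det_l a b c d :
  sigma (det_l sigma (mx2 a b c d)) = sigma d * a - sigma b * c.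
Proof.
by rewrite det_l_mx2 anti_involB !(anti_involM sigmaP) !(anti_involK sigmaP).
Qed.

(** Distributing sigma(a + d) over the entries of M produces in each entry one
    product that also occurs in sigma(M) M: the one with factor sigma(a) in the
    first row, the one with factor sigma(d) in the second.  Both have
    their factors in the same order, so they cancel without commutativity. *)
Lemma Cayley_Hamilton_mx2 a b c d (M := mx2 a b c d) :
  map_mx sigma M *m M - sigma (\tr M) *: M =
  - mx2 (sigma (det_l sigma M)) (twisted_comm_l sigma d b)
        (twisted_comm_l sigma a c) (det_l sigma M).
Proof.
rewrite /M anti_invol_det_l det_l_mx2 trace_mx2 (anti_involD sigmaP) map_mx2.
rewrite mul_mx2 scale_mx2 !opp_mx2 add_mx2 /twisted_comm_l !mulrDl !opprB.
congr mx2.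
- by rewrite [sigma a * a + _]addrC addrKA.
- by rewrite [sigma a * b + _]addrC addrKA.
- by rewrite [sigma a * c + _]addrC addrKA.
- by rewrite [sigma a * d + _]addrC addrKA.
Qed.

(** The entries of sigma(M)^T Omega1 M are the values of the form
    sigma(x1) y2 - sigma(x2) y1 on pairs of columns x, y of M.  It is
    skew-hermitian, so the two off-diagonal values differ by sigma and a sign;
    on a column with itself it is a twisted commutator. *)
Lemma symplectic_form_mx2 a b c d (M := mx2 a b c d) :
  (map_mx sigma M)^T *m Omega1 R *m M =
  mx2 (twisted_comm_l sigma a c) (det_l sigma M)
      (- sigma (det_l sigma M)) (- twisted_comm_l sigma d b).
Proof.
rewrite /M anti_invol_det_l det_l_mx2 map_mx2 trmx_mx2 !mul_mx2.
rewrite !mulr0 !mulr1 !mulrN1 !add0r !addr0 !mulNr /twisted_comm_l !opprB.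
by congr mx2; rewrite addrC.
Qed.

(** Equality of the lower left entries, - sigma(det_l M) = -1, follows from
    det_l M = 1, so three of the four scalar equations suffice. *)
Lemma mem_Sp2_l a b c d (M := mx2 a b c d) :
  M \in Sp2_l sigma <->
  [/\ twisted_comm_l sigma a c = 0, twisted_comm_l sigma d b = 0
    & det_l sigma M = 1].
Proof.
rewrite inE symplectic_form_mx2 -/M; split=> [/eqP E | [-> -> ->]].
  have [ac0 detM _ /eqP db0] := mx2_inj E.
  by split=> //; apply/eqP; rewrite -oppr_eq0.
by rewrite (anti_invol1 sigmaP) oppr0.
Qed.

End Mx2Ring.

Theorem theorem4p4 (R : pzRingType) (sigma : R -> R)
  (sigmaP : anti_involution sigma) (M : 'M[R]_2) :
  (forall A B C D : R, M = mx2 A B C D ->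
     map_mx sigma M *m M - sigma (\tr M) *: M =
     - mx2 (sigma (det_l sigma M)) (twisted_comm_l sigma D B)
           (twisted_comm_l sigma A C) (det_l sigma M)) /\
  (M \in Sp2_l sigma <->
     map_mx sigma M *m M - sigma (\tr M) *: M + 1%:M = 0).
Proof.
split=> [A B C D ->|]; first exact: Cayley_Hamilton_mx2.
rewrite (mx2_eta M); apply: (iff_trans (mem_Sp2_l sigmaP _ _ _ _)).
rewrite (Cayley_Hamilton_mx2 sigmaP) one_mx2 addrC.
split=> [[-> -> ->] | /subr0_eq E].
  by rewrite (anti_invol1 sigmaP) subrr.
by have [_ <- <- <-] := mx2_inj E.
Qed.
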